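(* The polynomial map $$T(x,y,z)=\bigl(2xz-y,\ z,\ 4xz^2-2yz-x\bigr)$$ preserves the Fricke function $\Delta(x,y,z)=1-x^2-y^2-z^2+2xyz$, that is, $\Delta\circ T=\Delta$. Consequently every level surface $$\mathcal S_\delta=\{(x,y,z)\in\mathcal B:\Delta(x,y,z)=\delta\},\qquad 0\le\delta\le1,$$ is invariant under $T$.
   Context: $\mathcal B=\{(x,y,z)\in[-1,1]^3: x^2+y^2+z^2-2xyz\le1\}$. It is the image of $\mathrm{SU}(2)^2/\mathrm{SU}(2)$ (quotient by simultaneous conjugation) under the trace coordinates $x=\tfrac12\operatorname{tr}(q_1)$, $y=\tfrac12\operatorname{tr}(q_2)$, $z=\tfrac12\operatorname{tr}(q_1q_2)$, which identify the quotient with $\mathcal B$. The map $T:\mathcal B\to\mathcal B$ is the map induced in these coordinates by the diffeomorphism $F(q_1,q_2)=(q_1^2q_2,q_1q_2)$ of $\mathrm{SU}(2)^2$. *)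

(* Defs.v *)
From HB Require Import structures.
From mathcomp Require Import all_boot all_order all_algebra.
From mathcomp Require Import boolp classical_sets reals.
From mathcomp Require Import complex ring.

Set Implicit Arguments.
Unset Strict Implicit.
Unset Printing Implicit Defensive.

Import Order.TTheory GRing.Theory Num.Theory.

Local Open Scope classical_set_scope.
Local Open Scope ring_scope.

Definition Delta (R : realType) (p : R * R * R) : R :=
  let: (x, y, z) := p in 1 - x ^+ 2 - y ^+ 2 - z ^+ 2 + 2 * x * y * z.

Definition T (R : realType) (p : R * R * R) : R * R * R :=
  let: (x, y, z) := p in
  (2 * x * z - y, z, 4 * x * z ^+ 2 - 2 * y * z - x).

Definition calB (R : realType) : set (R * R * R) :=
  [set p | let: (x, y, z) := p in
    [/\ -1 <= x <= 1, -1 <= y <= 1, -1 <= z <= 1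
      & x ^+ 2 + y ^+ 2 + z ^+ 2 - 2 * x * y * z <= 1]].

Definition level_surface (R : realType) (delta : R) : set (R * R * R) :=
  [set p | calB p /\ Delta p = delta].

Definition SU2 (R : realType) : set 'M[R[i]]_2 :=
  [set q | q *m (map_mx conjc q)^T = 1%:M /\ \det q = 1].

(* Traces of elements of SU(2) are real, so taking the real part of the trace
   loses nothing. *)
Definition trace_coords (R : realType) (q : 'M[R[i]]_2 * 'M[R[i]]_2) :
    R * R * R :=
  (complex.Re (\tr q.1) / 2, complex.Re (\tr q.2) / 2,
   complex.Re (\tr (q.1 *m q.2)) / 2).

Definition F (R : realType) (q : 'M[R[i]]_2 * 'M[R[i]]_2) :
    'M[R[i]]_2 * 'M[R[i]]_2 :=
  (q.1 *m q.1 *m q.2, q.1 *m q.2).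

Lemma SU2P (R : realType) (q : 'M[R[i]]_2) : SU2 q ->
  exists a b c d : R,
    [/\ a ^+ 2 + b ^+ 2 + c ^+ 2 + d ^+ 2 = 1,
        q 0 0 = Complex a b, q 0 1 = Complex c d,
        q 1 0 = Complex (- c) d & q 1 1 = Complex a (- b)].
Proof.
move=> [qU qD].
have qA : (map_mx conjc q)^T = \adj q.
  by rewrite -[LHS]mul1mx -[1%:M](congr1 scalar_mx qD) -mul_adj_mx -mulmxA qU
    mulmx1.
have e1 : lift ord0 ord0 = 1 :> 'I_2 by exact/val_inj.
have c11 := congr1 (fun M : 'M_2 => M 0 0) qA.
have c01 := congr1 (fun M : 'M_2 => M 1 0) qA.
have n := congr1 (fun M : 'M_2 => M 0 0) qU.
have r01 : row' 0 (col' 1 q) 0 0 = q 1 0.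
  by rewrite !mxE; congr (q _ _); exact/val_inj.
rewrite !mxE /cofactor det_mx11 ?r01 ?mxE /= ?e1 ?expr0 ?expr1 in c11 c01.
rewrite !mxE !big_ord_recl big_ord0 !mxE /= e1 in n.
have e0 : @ord0 1 = 0 by [].
rewrite e0 in n.
move: c11 c01 n.
case: (q 0 0) => a b; case: (q 0 1) => c d.
rewrite mul1r mulN1r => <- /(congr1 -%R).
rewrite det_mx11 r01 opprK => <- [n _].
exists a, b, c, d; split=> //=; last by congr Complex; rewrite opprK.
by rewrite -n; ring.
Qed.

(* The polynomial map [T] is the map induced by [F] in trace coordinates. *)
Lemma T_induced (R : realType) (q : 'M[R[i]]_2 * 'M[R[i]]_2) :
  SU2 q.1 -> SU2 q.2 -> trace_coords (F q) = T (trace_coords q).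
Proof.
case: q => q r /= /SU2P[a [b [c [d [n q00 q01 q10 q11]]]]].
move=> /SU2P[a' [b' [c' [d' [n' r00 r01 r10 r11]]]]].
rewrite /trace_coords /F /T /= /mxtrace !big_ord_recl !big_ord0 /=.
have e0 : @ord0 1 = 0 by [].
have e1 : lift ord0 ord0 = 1 :> 'I_2 by exact/val_inj.
rewrite !mxE !big_ord_recl !big_ord0 /= !mxE !big_ord_recl !big_ord0 /= .
rewrite !mxE !big_ord_recl !big_ord0 /= !e1 !e0 !q00 !q01 !q10 !q11.
rewrite !r00 !r01 !r10 !r11 /=.
congr (_, _, _).
- transitivity (2 * a * (a * a' - b * b' - c * c' - d * d')
    - (a ^+ 2 + b ^+ 2 + c ^+ 2 + d ^+ 2) * a'); first by field.
  by rewrite n; field.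
- transitivity (4 * a * (a * a' - b * b' - c * c' - d * d') ^+ 2
    - (a ^+ 2 + b ^+ 2 + c ^+ 2 + d ^+ 2) *
      (2 * a' * (a * a' - b * b' - c * c' - d * d'))
    - (a ^+ 2 + b ^+ 2 + c ^+ 2 + d ^+ 2) *
      (a' ^+ 2 + b' ^+ 2 + c' ^+ 2 + d' ^+ 2) * a); first by field.
  by rewrite n n'; field.
Qed.

(* Main.v *)
(** The Fricke function is quadratic in each coordinate, and [T] is composed of
    a permutation of coordinates and two Vieta involutions, each exchanging the
    two roots of one of these quadratics; hence [T] is bijective and preserves
    [Delta].  Once two coordinates lie in [[-1, 1]], the condition
    [0 <= Delta] forces the third one to do so, hence [T] and its inverse both
    preserve [calB]. *)
Require Import Defs.
From mathcomp Require Import all_boot all_order all_algebra.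
From mathcomp Require Import boolp classical_sets reals.
From mathcomp Require Import ring lra.

Import Order.TTheory GRing.Theory Num.Theory.
Local Open Scope classical_set_scope.
Local Open Scope ring_scope.

(** Solves [T (x, y, z) = (u, v, w)]: [z = v], then [w = 2 * u * v - x] yields [x], and
    [u = 2 * x * v - y] yields [y]. *)
Definition Tinv {R : realType} (p : R * R * R) : R * R * R :=
  let: (u, v, w) := p in
  (2 * u * v - w, 2 * (2 * u * v - w) * v - u, v).

Lemma TinvK (R : realType) : cancel (@Tinv R) (@T R).
Proof. by case=> [[u v] w]; rewrite /T /Tinv; congr (_, _, _); ring. Qed.

Lemma Delta_T (R : realType) (p : R * R * R) : Delta (T p) = Delta p.
Proof. by case: p => [[x y] z]; rewrite /Delta /T; ring. Qed.

Lemma Delta_ge0_le1 (R : realType) (x y z : R) :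
  -1 <= x <= 1 -> -1 <= z <= 1 -> 0 <= Delta (x, y, z) -> y <= 1.
Proof.
move=> /andP[x1 x2] /andP[z1 z2]; rewrite /Delta => D0.
rewrite leNgt; apply/negP => y1.
have xz : x * z <= 1 by nra.
(* [(y - x z)^2 <= (1 - x^2) (1 - z^2) = (1 - x z)^2 - (x - z)^2] *)
have : (y - x * z) ^+ 2 <= (1 - x * z) ^+ 2.
  rewrite -subr_ge0; have := sqr_ge0 (x - z).
  by move: D0; rewrite !expr2; nra.
(* As [x * z <= 1 < y], both bases are nonnegative; taking roots gives [y <= 1], a contradiction. *)
by rewrite ler_sqr ?nnegrE; lra.
Qed.

Lemma Delta_ge0_itv (R : realType) (x y z : R) :
  -1 <= x <= 1 -> -1 <= z <= 1 -> 0 <= Delta (x, y, z) -> -1 <= y <= 1.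
Proof.
move=> x1 z1 D0; rewrite (@Delta_ge0_le1 _ x y z) // andbT lerNl.
(* The lower bound is the upper bound for [- y], since negating [y] and [z] together preserves
   [Delta]. *)
apply: (@Delta_ge0_le1 _ x _ (- z)) => //; first by lra.
by have -> : Delta (x, - y, - z) = Delta (x, y, z) by rewrite /Delta; ring.
Qed.

Lemma calB_swap12 (R : realType) (x y z : R) : calB (x, y, z) -> calB (y, x, z).
Proof. by move=> [x1 y1 z1 D1]; split=> //; lra. Qed.

Lemma calB_swap23 (R : realType) (x y z : R) : calB (x, y, z) -> calB (x, z, y).
Proof. by move=> [x1 y1 z1 D1]; split=> //; lra. Qed.

Lemma calB_vieta (R : realType) (x y z : R) :
  calB (x, y, z) -> calB (x, 2 * x * z - y, z).
Proof.
move=> [x1 _ z1 D1].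
have D0 : 0 <= Delta (x, 2 * x * z - y, z).
  have -> : Delta (x, 2 * x * z - y, z)
      = 1 - (x ^+ 2 + y ^+ 2 + z ^+ 2 - 2 * x * y * z).
    by rewrite /Delta; ring.
  by rewrite subr_ge0.
split=> //; first exact: Delta_ge0_itv D0.
by rewrite -subr_ge0; apply: le_trans D0 _; rewrite /Delta; lra.
Qed.

Lemma calB_T (R : realType) (p : R * R * R) : calB p -> calB (T p).
Proof.
(* With [u = 2 * x * z - y], the chain runs through [(x, u, z)], [(u, x, z)],
   [(u, 2 * u * z - x, z)] and [(u, z, 2 * u * z - x)]. *)
case: p => [[x y] z] /calB_vieta/calB_swap12/calB_vieta/calB_swap23 B.
suff -> : T (x, y, z)
    = (2 * x * z - y, z, 2 * (2 * x * z - y) * z - x) by [].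
by rewrite /T; congr (_, _, _); ring.
Qed.

Lemma calB_Tinv (R : realType) (p : R * R * R) : calB p -> calB (Tinv p).
Proof.
by case: p => [[u v] w] /calB_swap23/calB_vieta/calB_swap12/calB_vieta.
Qed.

Theorem proposition10p1 (R : realType) :
  (@Delta R \o @T R = @Delta R) /\
  (forall delta : R, 0 <= delta <= 1 ->
    @T R @` level_surface delta = level_surface delta).
Proof.
split; first by apply/funext => p; exact: Delta_T.
move=> delta _; apply/seteqP; split=> [_ [p [Bp Dp] <-]|p [Bp Dp]].
  by split; [exact: calB_T | rewrite Delta_T].
(* The level is kept: [Delta (Tinv p) = Delta (T (Tinv p)) = Delta p]. *)
exists (Tinv p); last exact: TinvK.
by split; [exact: calB_Tinv | rewrite -Delta_T TinvK].
Qed.
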